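(* Let $n\ge 3$. Assume that $w\in F$ is a reduced word that contains a factor of the form $x_nq_i=x_nx_1\cdots x_ix_{n-1}\cdots x_{i+1}$ for some $i\in\{0,\ldots,n-2\}$. Then $$w=a(x_nx_1\cdots x_ix_{n-1}\cdots x_{i+1})^kb$$ for some $a\in A_i$, $b\in B_i$ and some $k\geq 1$. Moreover, all words of this type are reduced.
   Context: $F$ is the free monoid on $x_1,\dots,x_n$. For $w,v\in F$, $w$ is a factor of $v$ if $v=v_1wv_2$ for some $v_1,v_2\in F$. $|w|_q$ is the number of occurrences of $x_q$ in $w$. For indices $i,j\in\{1,\dots,n\}$, $x_i\cdots x_j$ denotes the product of all consecutive generators from $x_i$ up to $x_j$ if $i\le j$, or down to $x_j$ if $i>j$; in $q_i=x_1\cdots x_ix_{n-1}\cdots x_{i+1}$ the first part is empty for $i=0$, so $q_0=x_{n-1}\cdots x_1$. Let $S$ be the system of reductions consisting of the following pairs: (1) $(x_ix_i,x_i)$ for all $i\in\{1,\dots,n\}$; (2) $(x_jx_i,x_ix_j)$ for all $i,j\in\{1,\dots,n\}$ with $1<j-i<n-1$; (3) $(x_n(x_1\cdots x_i)x_j,\;x_jx_n(x_1\cdots x_i))$ for all $i,j\in\{1,\dots,n\}$ with $i+1<j<n-1$; (4) $(x_iux_i,x_iu)$ for all $i\in\{1,\dots,n\}$ and $1\ne u\in F$ with $|u|_i=|u|_{i-1}=0$ (where $i-1:=n$ if $i=1$); (5) $(x_ivx_i,vx_i)$ for all $i\in\{1,\dots,n\}$ and $1\neq v\in F$ with $|v|_i=|v|_{i+1}=0$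 (where $i+1:=1$ if $i=n$). A word in $F$ is reduced if it has no factor equal to the first component of a pair in $S$. (The reduced words are normal forms for the elements of the Hecke--Kiselman monoid $C_n$ of the oriented cycle $x_1\to x_2\to\cdots\to x_n\to x_1$.) For $0\le i\le n-2$, $A_i$ is the set of all suffixes (including the empty word and the full word) of words $$(x_{k_s}\cdots x_s)(x_{k_{s+1}}\cdots x_{s+1})\cdots(x_{k_{i+1}}\cdots x_{i+1}),$$ where $s\in\{0,\dots,i+1\}$, $k_{s+1}<k_{s+2}<\cdots<k_{i+1}\le n-1$, $1\le k_s\le s$, and $k_q>q$ for $q=s+1,\dots,i+1$; for $s=0$ the first block is omitted (only the conditions on $k_1,\dots,k_{i+1}$ remain), and for $s=i+1$ the word is $x_{k_{i+1}}\cdots x_{i+1}$ with $1\le k_{i+1}\le i+1$. $B_i$ is the set of all prefixes (including the empty word and the full word) of words $$x_n(x_1\cdots x_{i_1}x_{n-1}\cdots x_{j_1})\cdots x_n(x_1\cdots x_{i_r}x_{n-1}\cdots x_{j_r})\,x_nx_{n-1}\cdots x_{j_{r+1}},$$ where $r\ge 0$, $1\le i_r<i_{r-1}<\cdots<i_1<i+1$ and $i+1<j_1<j_2<\cdots<j_{r+1}\le n$; for $r=0$ these are the words $x_nx_{n-1}\cdots x_{j_1}$ with $i+1<j_1\le n$. The last block $x_nx_{n-1}\cdots x_{j_{r+1}}$ is just $x_n$ if $j_{r+1}=n$.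
   Formalization: In B_i the bound j_{r+1} ≤ n is relaxed to j_{r+1} ≤ n+1 (empty descending products allowed), adding words ending in x_n x_1⋯x_{i_r}; with the literal B_i the claim fails, e.g. n=3, i=1, w = x_3x_1x_2x_3x_1. *)

(* Defs.v *)
From mathcomp Require Import all_boot.

Set Implicit Arguments.
Unset Strict Implicit.
Unset Printing Implicit Defensive.

(* The generator x_q is the number q, 1 <= q <= n; the free monoid F on
   x_1, ..., x_n consists of the v : seq nat with inF n v, under ++. *)
Definition inF (n : nat) (v : seq nat) : bool := all (fun q => 1 <= q <= n) v.

(* The product x_i ... x_j of consecutive generators, increasing if i <= j and
   decreasing if i > j; it is never empty. *)
Definition run (i j : nat) : seq nat :=
  if i <= j then iota i (j - i).+1 else rev (iota j (i - j).+1).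

(* Here iota 1 i is x_1 ... x_i, empty for i = 0 (unlike run 1 0). *)
Definition q_word (n i : nat) : seq nat := iota 1 i ++ run n.-1 i.+1.

Definition cpred (n i : nat) : nat := if i == 1 then n else i.-1.
Definition csucc (n i : nat) : nat := if i == n then 1 else i.+1.

(* Sred n l r: the pair (l, r) belongs to the system of reductions. *)
Inductive Sred (n : nat) : seq nat -> seq nat -> Prop :=
| Sred1 i of 1 <= i <= n :
    Sred n [:: i; i] [:: i]
| Sred2 i j of 1 <= i <= n & 1 <= j <= n & 1 < j - i < n - 1 :
    Sred n [:: j; i] [:: i; j]
| Sred3 i j of 1 <= i <= n & 1 <= j <= n & i + 1 < j < n - 1 :
    Sred n (n :: run 1 i ++ [:: j]) (j :: n :: run 1 i)
| Sred4 i u of 1 <= i <= n & inF n u & u <> [::]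
    & count_mem i u = 0 & count_mem (cpred n i) u = 0 :
    Sred n (i :: u ++ [:: i]) (i :: u)
| Sred5 i v of 1 <= i <= n & inF n v & v <> [::]
    & count_mem i v = 0 & count_mem (csucc n i) v = 0 :
    Sred n (i :: v ++ [:: i]) (v ++ [:: i]).

Definition reduced (n : nat) (w : seq nat) : Prop :=
  inF n w /\ forall l r, Sred n l r -> ~~ infix l w.

(* (x_{k_s} ... x_s)(x_{k_(s+1)} ... x_{s+1}) ... (x_{k_(i+1)} ... x_{i+1}),
   starting at the block of index 1 when s = 0. *)
Definition A_word (i s : nat) (k : nat -> nat) : seq nat :=
  flatten [seq run (k q) q | q <- index_iota (maxn 1 s) i.+2].

Definition inA (n i : nat) (a : seq nat) : Prop :=
  exists (s : nat) (k : nat -> nat),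
    [/\ s <= i.+1,
        0 < s -> 1 <= k s <= s,
        forall q, s < q <= i.+1 -> q < k q,
        (forall q, s < q < i.+1 -> k q < k q.+1) /\ k i.+1 <= n - 1
      & suffix a (A_word i s k)].

(* x_i ... x_j for i >= j only; empty for j = i + 1 (unlike run i i.+1). *)
Definition desc (i j : nat) : seq nat := rev (iota j (i.+1 - j)).

Definition B_word (n r : nat) (I J : nat -> nat) : seq nat :=
  flatten [seq n :: run 1 (I t) ++ desc n.-1 (J t) | t <- iota 1 r]
    ++ desc n (J r.+1).

(* The bound on j_{r+1} is n + 1, not n as in the source.  For j_{r+1} <= n
   these are the words of the source.  For j_{r+1} = n + 1 the last block
   x_n ... x_{j_{r+1}} is empty and j_r may be n, in which case the r-th block
   is x_n x_1 ... x_{i_r}; this adds the words ending, after a block with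
   j_{r-1} = n - 1 (or after no block when i = n - 2), in x_n x_1 ... x_{i_r}.
   Without them the theorem is false: for n = 3 and i = 1, the word
   (x_3 x_1 x_2) x_3 x_1 is reduced, but B_1 would be {1, x_3}; for n = 5 and
   i = 2, (x_5 x_1 x_2 x_4 x_3) x_5 x_1 x_2 x_4 x_5 x_1 would be missing. *)
Definition inB (n i : nat) (b : seq nat) : Prop :=
  exists (r : nat) (I J : nat -> nat),
    [/\ forall t, 1 <= t <= r -> 1 <= I t < i.+1,
        forall t, 1 <= t < r -> I t.+1 < I t,
        i.+1 < J 1,
        (forall t, 1 <= t <= r -> J t < J t.+1) /\ J r.+1 <= n.+1
      & prefix b (B_word n r I J)].

(* v ^ k in the free monoid *)
Definition wpow (v : seq nat) (k : nat) : seq nat := flatten (nseq k v).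

(* Main.v *)
Require Import Defs.
From mathcomp Require Import all_boot.
From mathcomp Require Import zify.

(** Rules (1), (4) and (5) together say that between two consecutive
    occurrences of a letter x_c both cyclic neighbours x_{c-1} and x_{c+1}
    occur.  Hence, to know whether x_c may be put in front of a word w that
    contains every letter, it is enough to know, for each of the n edges
    {p, p + 1} of the cycle, which endpoint occurs first in w.  Place a particle
    at p when p + 1 occurs before p (the sites are 0, ..., n - 1, and the letter
    n belongs to site 0): then x_c may be put in front exactly when there is a
    particle at c and none at c - 1, and doing so moves that particle from c
    to c - 1 ([addableE], [occupied_cons]).  Reading words from the right end,
    the same rule governs adding a letter at the end.  Rules (2) and (3) only
    select one order among the commuting moves.

    Seen from the left, the word spin n i = x_n q_i has particles at
    i + 1, ..., n - 1.  Playing the game from there, one particle after another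
    can be moved towards 0, and the configurations are recorded by the holes
    k_m < ... < k_{i+1} left among the sites, together with the holes
    0, ..., m - 2 that are still untouched ([occupied_stair]).  The words that
    realise these configurations in the order imposed by (2) and (3) are the
    products of descents x_{k_q} ... x_q, and they are exactly the elements of
    A_i.  A further letter either continues the first descent, or starts a new
    descent, or is x_n; in the last case the word read so far is the full
    x_n q_i ([normal_cons_stair]).

    Seen from the right, spin n i has particles at 0, ..., i.  A turn
    x_n x_1 ... x_a x_{n-1} ... x_b carries the particle of site 0 around the
    cycle to site b - 1 and leaves a hole at a ([occupied_loops]); the words
    obtained in this way are the elements of B_i, and a further letter either
    extends such a word to another one or completes x_n q_i
    ([normal_rcons_loop]).

    Both directions of the theorem follow by adding one letter at a time: a
    reduced word containing x_n q_i is read outwards from that factor, and each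
    completed x_n q_i is absorbed into the power; conversely every letter of
    a (x_n q_i)^k b is an allowed move ([stair_normal], [loop_normal],
    [wpow_normal]). *)

Set Implicit Arguments.
Unset Strict Implicit.
Unset Printing Implicit Defensive.

(** * Rules as conditions on factors *)

Lemma run1 i : 0 < i -> run 1 i = iota 1 i.
Proof. by move=> i0; rewrite /run i0 subn1 prednK. Qed.

(** The last clause merges (1), (4) and (5): it is (1) when v is empty, and the
    failure of either membership is (4) or (5) otherwise. *)
Definition normal_word (n : nat) (w : seq nat) : Prop :=
  [/\ inF n w,
      forall u v a b, w = u ++ a :: b :: v -> ~~ (1 < a - b < n - 1),
      forall u v i j, w = u ++ n :: iota 1 i ++ j :: v -> 0 < i ->
        ~~ (i.+1 < j < n - 1)
    & forall u c v t, w = u ++ c :: v ++ c :: t -> c \notin v ->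
        cpred n c \in v /\ csucc n c \in v].

Lemma inF_cat n u v : inF n (u ++ v) = inF n u && inF n v.
Proof. exact: all_cat. Qed.

Lemma inFP n v c : inF n v -> c \in v -> 1 <= c <= n.
Proof. by move=> /allP h /h. Qed.

Lemma reduced_normal n w : 3 <= n -> reduced n w <-> normal_word n w.
Proof.
move=> n3; split=> [[wF h]|[wF h2 h3 hc]].
  split=> // [u v a b e|u v i j e i0|u c v t e cv].
  - apply/negP=> hab.
    have : infix [:: a; b] w by rewrite e; apply/infixP; exists u, v.
    have hm := inFP wF; rewrite e in hm.
    have ha : a \in u ++ a :: b :: v by rewrite mem_cat inE eqxx orbT.
    have hb : b \in u ++ a :: b :: v by rewrite mem_cat !inE eqxx !orbT.
    by apply/negP; exact: h _ _ (Sred2 (hm b hb) (hm a ha) hab).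
  - apply/negP=> hij.
    have : infix (n :: run 1 i ++ [:: j]) w.
      by rewrite e run1 //; apply/infixP; exists u, v; rewrite /= -catA.
    by apply/negP; apply: h (Sred3 _ _ _); lia.
  - have hF : inF n (u ++ c :: v ++ c :: t) by rewrite -e.
    have /andP[uF /= /andP[cF]] : inF n u && inF n (c :: v ++ c :: t).
      by rewrite -inF_cat.
    rewrite -/(inF _ _) inF_cat => /andP[vF _].
    have hinf : infix (c :: v ++ [:: c]) w.
      by rewrite e; apply/infixP; exists u, t; rewrite /= -catA.
    have cv0 : count_mem c v = 0 by apply/count_memPn.
    have v0 : v <> [::].
      by move=> v0; move: hinf; rewrite v0; apply/negP/h/Sred1.
    split; apply/negPn/negP=> /count_memPn hv; move: hinf; apply/negP.
      by apply: h (Sred4 _ _ _ _ _).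
    by apply: h (Sred5 _ _ _ _ _).
split=> // l r hlr; apply/negP; case: {r} hlr.
- move=> i hi /infixP[u [v e]].
  by have [] := hc u i [::] v e isT.
- move=> i j _ _ hij /infixP[u [v e]].
  by move: (h2 u v j i e); rewrite hij.
- move=> i j hi _ hij /infixP[u [v e]].
  have i0 : 0 < i by case/andP: hi.
  have ew : w = u ++ n :: iota 1 i ++ j :: v by rewrite e run1 //= -catA.
  by have := h3 u v i j ew i0; lia.
- move=> i u hi _ _ /count_memPn iu /count_memPn pu /infixP[u1 [v e]].
  have [] := hc u1 i u v _ iu; last by move=> hp; rewrite hp in pu.
  by rewrite e /= -catA.
- move=> i u hi _ _ /count_memPn iu /count_memPn pu /infixP[u1 [v e]].
  have [] := hc u1 i u v _ iu; last by move=> _ hp; rewrite hp in pu.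
  by rewrite e /= -catA.
Qed.

(** In terms of first occurrences, so that it can be tracked while letters are
    put in front of w; for the other end of a word it is used on [rev w]. *)
Definition addable (n : nat) (w : seq nat) (c : nat) : bool :=
  (index (cpred n c) w < index c w) && (index (csucc n c) w < index c w).

Lemma index_split (c : nat) v t : c \notin v ->
  index c (v ++ c :: t) = size v.
Proof. by move=> cv; rewrite index_cat (negbTE cv) /= eqxx addn0. Qed.

Lemma index_ltP (x c : nat) v t : c \notin v ->
  (index x (v ++ c :: t) < index c (v ++ c :: t)) = (x \in v).
Proof.
move=> cv; rewrite index_split // index_cat; case: ifP => [|_].
  by rewrite index_mem.
by rewrite ltnNge leq_addr.
Qed.

Lemma mem_split (c : nat) w : c \in w ->
  exists v t, w = v ++ c :: t /\ c \notin v.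
Proof.
elim: w => // x w IH; rewrite inE; have [->|cx /= /IH[v [t [-> cv]]]] := eqVneq c x.
  by exists [::], w.
by exists (x :: v), t; rewrite inE negb_or cx.
Qed.

(** Only factors starting at the new letter have to be examined, and among the
    pairs of equal letters only the new letter and its first occurrence in w. *)
Lemma normal_cons n c w : normal_word n (c :: w) <->
  [/\ normal_word n w, 1 <= c <= n, forall b v, w = b :: v -> ~~ (1 < c - b < n - 1),
     c = n -> forall i j v, 0 < i -> w = iota 1 i ++ j :: v ->
       ~~ (i.+1 < j < n - 1)
   & c \in w -> addable n w c].
Proof.
split=> [[/= /andP[cF wF] h2 h3 hc]|[[wF h2 h3 hc] cF h2' h3' hc']].
  split=> //.
  - split=> // [u v a b e|u v i j e i0|u d v t e cv].
    + by apply: (h2 (c :: u) v); rewrite e.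
    + by apply: (h3 (c :: u) v) => //; rewrite e.
    + by apply: (hc (c :: u) d v t) => //; rewrite e.
  - by move=> b v e; apply: (h2 [::] v); rewrite e.
  - by move=> cn i j v i0 e; apply: (h3 [::] v) => //; rewrite e cn.
  - case/mem_split=> v [t [e cv]].
    by rewrite e /addable !index_ltP //; apply/andP; apply: (hc [::] _ _ t) => //; rewrite e.
split=> [|[|x u] v a b /= [e1 e2]|[|x u] v i j /= [e1 e2] i0|[|x u] d v t /= [e1 e2] dv].
- by rewrite /inF /= cF.
- by rewrite -e1; apply: h2' e2.
- exact: h2 e2.
- exact: h3' e1 _ _ _ i0 e2.
- exact: h3 e2 i0.
- have cw : c \in w by rewrite e2 mem_cat e1 inE eqxx orbT.
  by apply/andP; move: (hc' cw); rewrite /addable e1 e2 !index_ltP.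
- exact: hc e2 dv.
Qed.

(** Mirror image of [normal_cons], except that rule (3) is not symmetric: here
    its last letter is the new one. *)
Lemma normal_rcons n c w : normal_word n (rcons w c) <->
  [/\ normal_word n w, 1 <= c <= n, forall u a, w = rcons u a -> ~~ (1 < a - c < n - 1),
     forall u i, 0 < i -> w = u ++ n :: iota 1 i -> ~~ (i.+1 < c < n - 1)
   & c \in w -> addable n (rev w) c].
Proof.
split=> [[wcF h2 h3 hc]|[[wF h2 h3 hc] cF h2' h3' hc']].
  have /andP[cF wF] : (1 <= c <= n) && inF n w by move: wcF; rewrite /inF all_rcons.
  split=> //.
  - split=> // [u v a b e|u v i j e i0|u d v t e cv].
    + by apply: (h2 u (rcons v c)); rewrite e rcons_cat.
    + by apply: (h3 u (rcons v c)) => //; rewrite e rcons_cat /= rcons_cat.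
    + by apply: (hc u d v (rcons t c)) => //; rewrite e rcons_cat /= rcons_cat.
  - by move=> u a e; apply: (h2 u [::]); rewrite e -cats1 cat_rcons.
  - by move=> u i i0 e; apply: (h3 u [::]) => //; rewrite e -cats1 -catA.
  - rewrite -mem_rev => /mem_split[v [t [e cv]]].
    rewrite e /addable !index_ltP // -!(mem_rev v); apply/andP.
    apply: (hc (rev t) _ _ [::]); last by rewrite mem_rev.
    by rewrite -[w in LHS]revK e rev_cat rev_cons cat_rcons -cats1 -catA.
have lastc u x y t : rcons w c = u ++ x :: rcons t y -> w = u ++ x :: t /\ c = y.
  by rewrite -rcons_cons -rcons_cat => /rcons_inj[-> ->].
split=> [|u v a b|u v i j|u d v t].
- by rewrite /inF all_rcons cF.
- case/lastP: v => [|v x].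
    by rewrite -[[:: b]]/(rcons [::] b) => /lastc[e <-]; apply: (h2' u); rewrite e cats1.
  by rewrite -rcons_cons => /lastc[e _]; apply: h2 e.
- case/lastP: v => [|v x].
    by rewrite cats1 => /lastc[e <-] i0; apply: h3' e.
  by rewrite -rcons_cons -rcons_cat => /lastc[e _]; apply: h3 e.
- case/lastP: t => [|t x].
    rewrite cats1 => /lastc[e ed] cv; rewrite -{d}ed in e cv *.
    have cw : c \in w by rewrite e mem_cat inE eqxx orbT.
    apply/andP; move: (hc' cw).
    by rewrite e rev_cat rev_cons cat_rcons /addable !index_ltP ?mem_rev.
  by rewrite -rcons_cons -rcons_cat => /lastc[e _]; apply: hc e.
Qed.

(** * The particle system on the cycle *)

(** A particle sits at p when the letter p + 1 is met before the letter p; the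
    letter of site 0 is n. *)
Definition occupied (n : nat) (w : seq nat) (p : nat) : bool :=
  index p.+1 w < index (if p == 0 then n else p) w.

(** The letter c becomes the first one to be met, so only the edges {c - 1, c}
    and {c, c + 1} are affected: the particle ends up at c - 1 and leaves the
    site of c (which is 0 when c = n). *)
Lemma occupied_cons n c w p : 3 <= n -> 1 <= c <= n -> p < n ->
  occupied n (c :: w) p =
  (p == c.-1) || [&& p != c, (p != 0) || (c != n) & occupied n w p].
Proof.
move=> n3 hc hp; rewrite /occupied /= 2!(eq_sym c).
by case: (eqVneq p 0) => [->|p0]; do 2 (case: eqVneq => ?); lia.
Qed.

(** The index of c cannot tie with that of its neighbour c - 1, as both letters
    occur in w; this is why a hole at c - 1 means that c - 1 comes first. *)
Lemma addableE n w c : 3 <= n -> 1 <= c <= n ->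
  (forall d, 1 <= d <= n -> d \in w) ->
  addable n w c = occupied n w (if c == n then 0 else c) && ~~ occupied n w c.-1.
Proof.
move=> n3 hc hw.
have ne : index (cpred n c) w != index c w.
  apply/negP=> /eqP e.
  have := nth_index 0 (hw c hc); rewrite -e nth_index; last first.
    by apply: hw; rewrite /cpred; case: eqP => ?; lia.
  by rewrite /cpred; case: eqP => ?; lia.
have e1 : (if c.-1 == 0 then n else c.-1) = cpred n c.
  by rewrite /cpred; case: eqP => ?; case: eqP => ?; lia.
rewrite /addable /occupied e1 prednK; last by lia.
have -> : (if c == n then 0 else c).+1 = csucc n c by rewrite /csucc; case: eqP.
have -> : (if (if c == n then 0 else c) == 0 then n else if c == n then 0 else c) = c.
  by case: (c =P n) => [->//|?]; case: (c =P 0) => ?; lia.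
by lia.
Qed.

(** * Descents, turns and spins *)

Lemma iota1S i : iota 1 i.+1 = rcons (iota 1 i) i.+1.
Proof. by rewrite -{1}[i.+1]addn1 iotaD cats1 add1n. Qed.

Lemma desc_nil k : desc k k.+1 = [::].
Proof. by rewrite /desc subnn. Qed.

Lemma descS k m : m <= k.+1 -> desc k.+1 m = k.+1 :: desc k m.
Proof.
move=> mk; rewrite /desc subSn // -addn1 iotaD rev_cat /=.
by rewrite subnKC.
Qed.

Lemma desc_rcons k m : m <= k -> desc k m = rcons (desc k m.+1) m.
Proof. by move=> mk; rewrite /desc subSn //= rev_cons subSS. Qed.

Lemma desc1 k : desc k k = [:: k].
Proof. by rewrite desc_rcons // desc_nil. Qed.

Lemma run_desc k m : m <= k -> run k m = desc k m.
Proof.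
move=> mk; rewrite /run /desc subSn //; case: leqP => // km.
have -> : k = m by lia.
by rewrite subnn.
Qed.

Lemma mem_desc k m c : (c \in desc k m) = (m <= c <= k).
Proof. by rewrite /desc mem_rev mem_iota; lia. Qed.

Lemma index_desc k m p : m <= p <= k -> index p (desc k m) = k - p.
Proof.
elim: k => [|k IH] hp; last first.
  rewrite descS /=; last by lia.
  by case: eqVneq => e; [lia | rewrite IH; lia].
have [-> ->] : m = 0 /\ p = 0 by lia.
by rewrite desc1.
Qed.

Lemma index_iota_mem m l p : m <= p < m + l -> index p (iota m l) = p - m.
Proof.
elim: l m => [|l IH] m hp /=; first by lia.
by case: eqVneq => e; [lia | rewrite IH; lia].
Qed.

(** The blocks of the elements of B_i: [desc] rather than [run] lets the
    decreasing part be empty (j = n). *)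
Definition turn (n i j : nat) : seq nat := n :: iota 1 i ++ desc n.-1 j.

(** The word x_n q_i is itself a turn, the only kind that can be repeated. *)
Definition spin (n i : nat) : seq nat := turn n i i.+1.

Lemma spinE n i : 2 <= n -> i <= n - 2 -> n :: q_word n i = spin n i.
Proof. by move=> n2 hi; rewrite /q_word run_desc //; lia. Qed.

Lemma mem_spin n i c : 3 <= n -> i <= n - 2 -> (c \in spin n i) = (1 <= c <= n).
Proof.
move=> n3 hi; rewrite inE mem_cat mem_iota mem_desc.
by case: eqVneq => ? /=; lia.
Qed.

Lemma occupied_spin n i w p : 3 <= n -> i <= n - 2 -> p < n ->
  occupied n (spin n i ++ w) p = (i < p).
Proof.
move=> n3 hi hp.
have idx c : 1 <= c < n -> index c (spin n i ++ w) = if c <= i then c else i + n - c.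
  move=> hc; rewrite index_cat mem_spin // (_ : 0 < c <= n) /=; last by lia.
  rewrite ifF; last by lia.
  rewrite index_cat mem_iota size_iota; case: ifP => h1.
    by rewrite index_iota_mem; [case: ifP|]; lia.
  by rewrite index_desc; [case: ifP|]; lia.
have idn : index n (spin n i ++ w) = 0 by rewrite /= eqxx.
rewrite /occupied; case: (p =P 0) => [->|p0]; first by rewrite idn; lia.
case: (p.+1 =P n) => [pn|pn]; first by rewrite pn idn idx; [case: ifP|]; lia.
by rewrite !idx; try (case: ifP; case: ifP); lia.
Qed.

(** The letters m, ..., k are put in front in this order: each particle of
    m, ..., k moves one step down, which leaves the hole k. *)
Lemma occupied_desc n k m w p : 3 <= n -> 1 <= m <= k -> k < n -> p < n ->
  occupied n (desc k m ++ w) p = (p != k) && ((m.-1 <= p < k) || occupied n w p).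
Proof.
move=> n3; elim: k => [|k IH] hm hk hp; first by lia.
rewrite descS /=; last by lia.
rewrite occupied_cons //; last by lia.
case: (m =P k.+1) => [->|mk].
  by rewrite desc_nil /=; lia.
by rewrite IH; lia.
Qed.

(** * Left factors: staircases *)

(** The entries of ks are the tops of successive descents, the last descent
    ending at i + 1 and the previous ones at i, i - 1, ...  An increasing block
    x_m ... x_s of the definition of A_i is recorded as the one-letter descents
    x_m, ..., x_s, so that the single inequality that a top is at least its end
    covers both kinds of blocks. *)
Fixpoint staircase (n i : nat) (ks : seq nat) : bool :=
  if ks is k :: ks' then
    [&& size ks' <= i, i.+1 - size ks' <= k < n, all (ltn k) ks'
      & staircase n i ks']
  else true.

Fixpoint stair_word (i : nat) (ks : seq nat) : seq nat :=
  if ks is k :: ks' then desc k (i.+1 - size ks') ++ stair_word i ks' else [::].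

Lemma staircase_bound n i ks k : staircase n i ks -> k \in ks -> 1 <= k < n.
Proof.
elim: ks => //= k' ks IH /and4P[h1 h2 h3 h4].
by rewrite inE => /predU1P[->|]; [lia | apply: IH].
Qed.

(** The holes are the sites not yet reached by any particle, and the tops. *)
Lemma occupied_stair n i ks w p : 3 <= n -> i <= n - 2 -> staircase n i ks -> p < n ->
  occupied n (stair_word i ks ++ spin n i ++ w) p =
  ~~ ((p < i.+1 - size ks) || (p \in ks)).
Proof.
move=> n3 hi; elim: ks => [|k ks IH] /= hks hp.
  by rewrite occupied_spin // in_nil; lia.
case/and4P: hks => hs hk /allP hlt hks.
rewrite -catA occupied_desc ?IH //; try lia.
rewrite inE; case: (p =P k) => [->|pk] //=; first by rewrite orbT.
case: (boolP (p \in ks)) => [/hlt /=|]; lia.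
Qed.

(** The one-letter descents come first: tops strictly increase while the ends of
    the descents grow by one, so once a top exceeds its end all later ones do. *)
Lemma staircase_split n i ks : staircase n i ks ->
  exists l ks2, [/\ ks = iota (i.+2 - size ks) l ++ ks2,
     staircase n i ks2 & forall k ks3, ks2 = k :: ks3 -> i.+1 - size ks3 < k].
Proof.
elim: ks => [|k ks IH] hk; first by exists 0, [::].
have /= /and4P[h1 h2 h3 h4] := hk.
case: (k =P i.+1 - size ks) => [e|ne]; last first.
  by exists 0, (k :: ks); split=> // _ _ [<- <-]; lia.
have [l [ks2 [e2 hs h]]] := IH h4.
exists l.+1, ks2; split=> //=.
rewrite subSS -e {1}e2; congr (_ :: iota _ _ ++ _).
by lia.
Qed.

Lemma size_iota_cat m l (ks : seq nat) : size (iota m l ++ ks) = l + size ks.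
Proof. by rewrite size_cat size_iota. Qed.

Lemma stair_word_iota i l ks : l + size ks <= i.+1 ->
  stair_word i (iota (i.+2 - (l + size ks)) l ++ ks) =
  iota (i.+2 - (l + size ks)) l ++ stair_word i ks.
Proof.
elim: l => [|l IH] //= h.
rewrite size_iota_cat addSn subSS desc1 /=.
have -> : (i.+1 - (l + size ks)).+1 = i.+2 - (l + size ks) by lia.
by rewrite IH //; lia.
Qed.

(** A movable particle sits just above a hole, that is, by [occupied_stair], above
    a site not yet reached or above a top.  Rule (2), applied to the first letter
    of the staircase word, excludes the tops other than the first. *)
Lemma normal_cons_stair n i ks w c : 3 <= n -> i <= n - 2 -> staircase n i ks ->
  normal_word n (c :: stair_word i ks ++ spin n i ++ w) ->
  (exists2 ks', staircase n i ks' & stair_word i ks' = c :: stair_word i ks)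
  \/ c :: stair_word i ks = spin n i.
Proof.
move=> n3 hi hks /normal_cons[_ cF h2 h3].
have cin d : 1 <= d <= n -> d \in stair_word i ks ++ spin n i ++ w.
  by move=> hd; rewrite !mem_cat mem_spin // hd orbT.
move/(_ (cin c cF)); rewrite addableE // !occupied_stair //; try by [lia | case: eqP; lia].
rewrite negbK => /andP[h4 h5].
case: ks hks h2 h3 h4 h5 {cin} => [|k ks] hks h2 h3 /= h4 h5.
  rewrite !in_nil !orbF in h4 h5.
  have ec : c = i.+1 by move: h4 h5; case: eqP => /=; lia.
  left; exists [:: i.+1]; rewrite /=; first by lia.
  by rewrite subn0 desc1 ec.
have := hks => /= /and4P[g1 g2 g3 g4].
have g3' : forall x, x \in ks -> k < x by apply/allP.
have hk : ~~ (1 < c - k < n - 1).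
  apply: (h2 k (desc k.-1 (i.+1 - size ks) ++ stair_word i ks ++ spin n i ++ w)).
  have [k0 e] : exists k0, k = k0.+1 by exists k.-1; lia.
  by rewrite e /= descS -?catA //; lia.
case: (c =P n) h4 => [cn|cn] h4; last first.
  (* The hole at c - 1 is either an untouched site, and c starts a new
     descent, or a top, and c continues the first descent. *)
  left; case: (ltnP c (i.+1 - size ks)) => hc.
    have ec : c = i - size ks by lia.
    exists (c :: k :: ks) => /=; last first.
      have -> : i.+1 - (size ks).+1 = c by lia.
      by rewrite desc1.
    rewrite g1 g2 g3 g4 /= (_ : c < k) ?andbT; last by lia.
    rewrite (_ : all (ltn c) ks); first by lia.
    by apply/allP=> x /g3' /=; lia.
  have hck : c.-1 = k.
    move: h5; rewrite inE subSS; case: (c.-1 =P k) => // _ /orP[|/=]; first by lia.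
    by move/g3'; lia.
  have {hck} ck : c = k.+1 by lia.
  exists (c :: ks); rewrite /= ?ck; last by rewrite descS //; lia.
  rewrite g1 g4 /= andbT (_ : all _ _) ?andbT; first by lia.
  apply/allP=> x xk /=; move: (g3' _ xk); rewrite leq_eqVlt => /predU1P[e|//].
  by move: h4; rewrite ck inE e xk !orbT.
(* The letter n needs a particle at 0 and a hole at n - 1: the descents go down
   to 1, and the last top is n - 1. *)
right; rewrite cn.
have sk : size ks = i by lia.
have hn : n.-1 \in k :: ks by move: h5; rewrite cn => /orP[|//]; lia.
case: (k =P n.-1) => [kn|kn].
  have k0 : ks = [::].
    case: ks g3' g4 {hks h2 h3 h4 h5 g1 g2 g3 sk hn} => // x ks g3' /= /and4P[_ g _ _].
    by have := g3' x (mem_head _ _); lia.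
  by rewrite /= k0 -sk k0 cats0 /= kn.
(* By rule (2) the first letter is now 1.  The word starts with 1 ... l, and
   rule (3) forces the next letter of the staircase word, if there is one, to
   be n - 1; the descent it starts is then the last one. *)
have k1 : k = 1 by lia.
have [l [ks2 [e hs2 hks2]]] := staircase_split hks.
have esz : i.+1 = l + size ks2 by have := congr1 size e; rewrite size_iota_cat /= sk.
have ew : desc k (i.+1 - size ks) ++ stair_word i ks = iota 1 l ++ stair_word i ks2.
  have -> : desc k (i.+1 - size ks) ++ stair_word i ks = stair_word i (k :: ks) by [].
  rewrite e.
  have -> : i.+2 - size (k :: ks) = i.+2 - (l + size ks2) by rewrite /= sk -esz.
  rewrite stair_word_iota; last by lia.
  by congr (iota _ _ ++ _); lia.
rewrite ew /spin /turn; congr (_ :: _).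
case: ks2 e hks2 hs2 esz ew => [|k2 ks3] e hks2 hs2 esz ew.
  rewrite /= addn0 in esz; rewrite cats0.
  have l1 : i = n - 2.
    by move: hn; rewrite e cats0 mem_iota /= sk -esz; lia.
  have -> : n.-1 = i.+1 by lia.
  by rewrite desc1 -esz iota1S cats1.
have /= hk2 := hks2 _ _ (erefl _).
have /= /and4P[f1 f2 f3 f4] := hs2.
have l0 : 0 < l.
  by case: l e esz ew => // -[e1 _] /= esz ew; lia.
have k2n : k2 = n.-1.
  have : ~~ (l.+1 < k2 < n - 1).
    apply: (h3 cn l k2 (desc k2.-1 (i.+1 - size ks3) ++ stair_word i ks3 ++ spin n i ++ w)) => //.
    have [k0 ek] : exists k0, k2 = k0.+1 by exists k2.-1; lia.
    by rewrite [stair_word i (k :: ks)]ew ek /= descS -?catA //= -?catA //; lia.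
  by move: esz => /=; lia.
have k30 : ks3 = [::].
  case: ks3 f3 f4 {hs2 hks2 ew f1 f2 e esz hk2} => // x ks3 /= /andP[f3 _] /and4P[_ f _ _].
  by lia.
rewrite k30 /= cats0 k2n subn0 in esz *.
by congr (iota _ _ ++ _); lia.
Qed.

(** A new letter is never n, so rule (3) does not apply to it; it is smaller than
    the letter it precedes or exceeds it by one, which rule (2) tolerates. *)
Lemma stair_normal n i ks w : 3 <= n -> i <= n - 2 -> staircase n i ks ->
  normal_word n (spin n i ++ w) -> normal_word n (stair_word i ks ++ spin n i ++ w).
Proof.
move=> n3 hi hks hw; elim: ks hks => // k ks IH.
have cin ks' d : 1 <= d <= n -> d \in stair_word i ks' ++ spin n i ++ w.
  by move=> hd; rewrite !mem_cat mem_spin // hd orbT.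
elim: k => [|k IHk] hks; first by move: hks => /=; lia.
have := hks; rewrite [staircase _ _ _]/= => /and4P[g1 g2 g3 g4].
have kn : k.+1 < n by case/andP: g2.
have g3' : forall x, x \in ks -> k.+1 < x by apply/allP.
case: (i.+1 - size ks =P k.+1) => [mk|mk].
  rewrite /= mk desc1 /=; apply/normal_cons; split; first exact: IH.
  - by lia.
  - case: ks g3' g1 g4 {IH IHk cin hks g2 g3 mk} => [|k' ks] g3' g1 g4 b v.
      by case=> <- _; lia.
    have := g3' k' (mem_head _ _); case: k' g1 g3' g4 => // k' g1 _ /= g4 kk'.
    by rewrite descS; [case=> <- _; lia | lia].
  - by lia.
  - move=> _; rewrite addableE //; [|lia|exact: cin].
    rewrite ifF; last by lia.
    rewrite !occupied_stair //; try lia.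
    rewrite /= (_ : (k.+1 \in ks) = false); first by lia.
    by apply/negP=> /g3'; lia.
have hks' : staircase n i (k :: ks).
  rewrite /= g1 g4 /= andbT (_ : all _ _) ?andbT; first by lia.
  by apply/allP=> x /g3' /=; lia.
have -> : stair_word i (k.+1 :: ks) = k.+1 :: stair_word i (k :: ks).
  by rewrite /= descS //; lia.
rewrite cat_cons; apply/normal_cons; split; first exact: IHk.
- by lia.
- move=> b v; have [k0 ek] : exists k0, k = k0.+1 by exists k.-1; lia.
  by rewrite ek /= descS; [case=> <- _; lia | lia].
- by lia.
- move=> _; rewrite addableE //; [|lia|exact: cin].
  rewrite ifF; last by lia.
  rewrite !occupied_stair //; try lia.
  rewrite !inE eqxx /= (_ : (k.+1 \in ks) = false); first by lia.
  by apply/negP=> /g3'; lia.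
Qed.

Lemma stair_behead n i ks c a : staircase n i ks -> stair_word i ks = c :: a ->
  exists2 ks', staircase n i ks' & a = stair_word i ks'.
Proof.
case: ks => //= k ks /and4P[g1 g2 /allP g3 g4].
case: k g2 g3 => [|k] g2 g3; first by lia.
rewrite descS => [[_ <-]|]; last by lia.
case: (i.+1 - size ks =P k.+1) => [->|mk]; first by exists ks; rewrite ?desc_nil.
exists (k :: ks) => //=; rewrite g1 g4 andbT (_ : all _ _) ?andbT; first by lia.
by apply/allP=> x /g3 /=; lia.
Qed.

Lemma stair_suffix n i ks a : staircase n i ks -> suffix a (stair_word i ks) ->
  exists2 ks', staircase n i ks' & a = stair_word i ks'.
Proof.
move=> hks /suffixP[t]; elim: t ks hks => [|c t IH] ks hks e; first by exists ks.
have [ks' hks' e'] := stair_behead hks e.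
exact: IH hks' (esym e').
Qed.

(** * Right factors: loops *)

(** The last letter of x_n x_1 ... x_i is i, so both (2) and (3) can be checked
    on the last letter of w. *)
Lemma normal_rcons_last n w c : normal_word n w -> 1 <= c <= n ->
  ~~ (1 < last 0 w - c < n - 1) -> ~~ ((last 0 w).+1 < c < n - 1) ->
  (c \in w -> addable n (rev w) c) -> normal_word n (rcons w c).
Proof.
move=> hw hc h2 h3 h; apply/normal_rcons; split=> //.
- by move=> u a e; move: h2; rewrite e last_rcons.
- move=> u i i0 e; move: h3; rewrite e last_cat [last _ _]/=.
  by case: i i0 {e} => // i _; rewrite iota1S last_rcons.
Qed.

Lemma last_turn n i j x : 0 < n -> j <= n ->
  last x (turn n i j) = if j < n then j else if i == 0 then n else i.
Proof.
case: n => // n _ jn; rewrite [last _ _]/= last_cat; case: ltnP => h.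
  by rewrite desc_rcons ?last_rcons //; lia.
have -> : j = n.+1 by lia.
by rewrite desc_nil; case: i => // i; rewrite iota1S last_rcons.
Qed.

Lemma turn0 n : 0 < n -> turn n 0 n = [:: n].
Proof. by case: n => // n _; rewrite /turn desc_nil. Qed.

Lemma turn_rcons_up n i : 0 < n -> turn n i.+1 n = rcons (turn n i n) i.+1.
Proof.
by case: n => // n _; rewrite /turn desc_nil !cats0 iota1S.
Qed.

Lemma turn_rcons_down n i j : j < n -> turn n i j = rcons (turn n i j.+1) j.
Proof.
by move=> jn; rewrite /turn desc_rcons -?rcons_cat //; lia.
Qed.

(** The hypotheses ask for the moves of a turn, letter by letter: first n, then
    the ascent 1, ..., i, during which the turn is [turn n i' n], then the
    descent n - 1, ..., j.  The last letters seen on the way never violate (2)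
    or (3). *)
Lemma turn_normal n w i j : 3 <= n -> i < j <= n -> i <= n - 2 ->
  normal_word n w -> (n \in w -> addable n (rev w) n) ->
  (forall i', i' < i -> i'.+1 \in w ++ turn n i' n ->
     addable n (rev (w ++ turn n i' n)) i'.+1) ->
  (forall j', j <= j' < n -> j' \in w ++ turn n i j'.+1 ->
     addable n (rev (w ++ turn n i j'.+1)) j') ->
  normal_word n (w ++ turn n i j).
Proof.
move=> n3 hij hi hw hn hup hdown.
have n0 : 0 < n by lia.
have up i' : i' <= i -> normal_word n (w ++ turn n i' n).
  elim: i' => [|i' IH] hi'.
    rewrite turn0 // cats1; apply: normal_rcons_last => //; try lia.
    have wF : last 0 w <= n.
      case: hw => wF _ _ _; case/lastP: w wF {hn hup hdown} => // u a.
      by rewrite last_rcons /inF all_rcons => /andP[/andP[_]].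
    by lia.
  rewrite turn_rcons_up // -rcons_cat; apply: normal_rcons_last.
  - by apply: IH; lia.
  - by lia.
  - by rewrite last_cat last_turn // ltnn; case: eqP; lia.
  - by rewrite last_cat last_turn // ltnn; case: eqP; lia.
  - by apply: hup; lia.
have down d : d <= n - j -> normal_word n (w ++ turn n i (n - d)).
  elim: d => [|d IH] hd; first by rewrite subn0; apply: up.
  have hS : (n - d.+1).+1 = n - d by lia.
  rewrite turn_rcons_down -?rcons_cat; last by lia.
  rewrite hS; apply: normal_rcons_last.
  - by apply: IH; lia.
  - by lia.
  - rewrite last_cat last_turn //; last by lia.
    by case: ifP; [lia | case: eqP; lia].
  - rewrite last_cat last_turn //; last by lia.
    by case: ifP; [lia | case: eqP; lia].
  - by rewrite -hS; apply: hdown; lia.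
have -> : j = n - (n - j) by lia.
exact: down.
Qed.

(** No letter occurs twice, so every move is allowed. *)
Lemma spin_normal n i : 3 <= n -> i <= n - 2 -> normal_word n (spin n i).
Proof.
move=> n3 hi; apply: (@turn_normal n [::]) => //; try lia.
- by split=> // [[|? ?]|[|? ?]|[|? ?]].
- move=> i' hi'; rewrite inE mem_cat mem_iota mem_desc.
  by case: eqP => /=; lia.
- move=> j' hj'; rewrite inE mem_cat mem_iota mem_desc.
  by case: eqP => /=; lia.
Qed.

Lemma occupied_iota n m l w p : 3 <= n -> 1 <= m -> m + l <= n -> p < n ->
  occupied n (iota m l ++ w) p =
  (0 < l) && (p.+1 == m) || ~~ (m <= p < m + l) && occupied n w p.
Proof.
move=> n3; elim: l m => [|l IH] m hm hl hp /=.
  by rewrite addn0 (_ : ~~ _) //; lia.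
by rewrite occupied_cons ?IH; lia.
Qed.

Lemma rev_turn n i j : j <= n -> 0 < n ->
  rev (turn n i j) = iota j (n - j) ++ desc i 1 ++ [:: n].
Proof.
move=> jn n0; rewrite rev_cons rev_cat /desc revK subn1 /= -cats1 -catA.
by rewrite prednK.
Qed.

(** The particle of site 0 goes to n - 1 and then down to j - 1, while those of
    1, ..., i move one step down and leave the hole i. *)
Lemma occupied_turn n i j w p : 3 <= n -> i <= n - 2 -> i < j <= n -> p < n ->
  occupied n (rev (turn n i j) ++ w) p =
  [|| p < i, p.+1 == j | [&& p != i, p < j & occupied n w p]].
Proof.
move=> n3 hi hij hp; rewrite rev_turn; try lia.
rewrite -!catA occupied_iota //; try lia.
case: i hi hij => [|i] hi hij.
  by rewrite desc_nil cat0s occupied_cons //; lia.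
by rewrite occupied_desc ?cat1s ?occupied_cons //; lia.
Qed.

(** The pairs (i_t, j_t) of the turns, latest turn first.  A turn that is cut
    short is still a turn: x_n ... x_j is [turn n 0 j], and x_n x_1 ... x_a is
    [turn n a n]; only the latest turn can be of this kind, since the first
    components increase along the list and the second ones decrease. *)
Fixpoint loops (n i : nat) (bs : seq (nat * nat)) : bool :=
  if bs is b :: bs' then
    [&& b.1 <= i, i.+1 < b.2 <= n, all (fun b' => (b.1 < b'.1) && (b'.2 < b.2)) bs'
      & loops n i bs']
  else true.

Fixpoint loop_word (n : nat) (bs : seq (nat * nat)) : seq nat :=
  if bs is b :: bs' then loop_word n bs' ++ turn n b.1 b.2 else [::].

Lemma loops_bound n i bs b : loops n i bs -> b \in bs ->
  (b.1 <= i) && (i.+1 < b.2 <= n).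
Proof.
elim: bs => //= b' bs IH /and4P[h1 h2 _ h4].
by rewrite inE => /predU1P[->|]; [rewrite h1 | apply: IH].
Qed.

(** Of the particles 0, ..., i those at the i_t are gone, and the t-th turn has
    parked one at j_t - 1. *)
Lemma occupied_loops n i u bs p : 3 <= n -> i <= n - 2 -> loops n i bs -> p < n ->
  occupied n (rev (u ++ spin n i ++ loop_word n bs)) p =
  (p <= i) && (p \notin unzip1 bs) || (p.+1 \in unzip2 bs).
Proof.
move=> n3 hi; elim: bs => [|[a b] bs IH] hbs hp.
  rewrite cats0 rev_cat occupied_turn //; last by lia.
  by rewrite !in_nil; lia.
have := hbs; rewrite [loops _ _ _]/= => /and4P[h1 h2 /allP h3 h4].
have -> : loop_word n ((a, b) :: bs) = loop_word n bs ++ turn n a b by [].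
rewrite !catA rev_cat occupied_turn //; try lia.
rewrite -catA IH //= !inE.
have hI : p \in unzip1 bs -> a < p <= i.
  by case/mapP=> [[x y] xbs /= ->]; have /= := h3 _ xbs; have /= := loops_bound h4 xbs; lia.
have hJ : p.+1 \in unzip2 bs -> i.+1 < p.+1 < b.
  by case/mapP=> [[x y] xbs /= ->]; have /= := h3 _ xbs; have /= := loops_bound h4 xbs; lia.
case: (boolP (p \in unzip1 bs)) hI => [_ /(_ isT)|_ _];
  by case: (boolP (p.+1 \in unzip2 bs)) hJ => [_ /(_ isT)|_ _]; lia.
Qed.

(** The case b = i + 1 is allowed only for a = i; then bs is empty and the turn
    is another spin.  Every intermediate stage of the turn is a loop word, so
    [occupied_loops] gives its configuration. *)
Lemma loop_turn_normal n i u bs a b : 3 <= n -> i <= n - 2 -> loops n i bs ->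
  a <= i -> i < b <= n -> (b = i.+1 -> a = i) ->
  all (fun b' => (a < b'.1) && (b'.2 < b)) bs ->
  normal_word n (u ++ spin n i ++ loop_word n bs) ->
  normal_word n (u ++ spin n i ++ loop_word n bs ++ turn n a b).
Proof.
move=> n3 hi hbs ha hb hab /allP hall hR.
rewrite [spin _ _ ++ _]catA catA.
have cin bs' d : 1 <= d <= n -> d \in rev (u ++ spin n i ++ loop_word n bs').
  by move=> hd; rewrite mem_rev !mem_cat mem_spin // hd orbT.
have h1 x : x \in unzip1 bs -> a < x by move=> /mapP[y /hall /andP[h _] ->].
have h2 x : x \in unzip2 bs -> x < b by move=> /mapP[y /hall /andP[_ h] ->].
have h2' x : x \in unzip2 bs -> i.+1 < x.
  by case/mapP=> [[y z] /(loops_bound hbs) /= hy ->]; lia.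
have hl a' b' : a' <= a -> b <= b' <= n -> i.+1 < b' -> loops n i ((a', b') :: bs).
  move=> ha' hb' hb''; rewrite /= hbs andbT (_ : all _ _) ?andbT; first by lia.
  by apply/allP=> x /hall; lia.
apply: turn_normal => //; try lia.
- move=> _; rewrite addableE //; [|lia|exact: cin].
  rewrite eqxx !occupied_loops //; try lia.
  rewrite prednK; last by lia.
  have -> : (n \in unzip2 bs) = false by apply/negP=> /h2; lia.
  have -> : (0 \in unzip1 bs) = false by apply/negP=> /h1; lia.
  by lia.
- move=> a' ha' _; rewrite -!catA.
  have /occupied_loops hocc := hl a' n ltac:(lia) ltac:(lia) ltac:(lia).
  rewrite addableE //; [|lia|exact: (cin ((a', n) :: bs))].
  rewrite ifF; last by lia.
  rewrite !(hocc u) //; try lia.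
  rewrite /= !inE /=.
  have -> : (a'.+1 \in unzip1 bs) = false by apply/negP=> /h1; lia.
  have -> : (a'.+1 \in unzip2 bs) = false by apply/negP=> /h2'; lia.
  by lia.
- move=> b' hb' _; rewrite -!catA.
  have /occupied_loops hocc := hl a b'.+1 ltac:(lia) ltac:(lia) ltac:(lia).
  rewrite addableE //; [|lia|exact: (cin ((a, b'.+1) :: bs))].
  rewrite ifF; last by lia.
  rewrite !(hocc u) //; try lia.
  rewrite /= !inE /= prednK; last by lia.
  have -> : (b' \in unzip2 bs) = false by apply/negP=> /h2; lia.
  by lia.
Qed.

Lemma loop_normal n i u bs : 3 <= n -> i <= n - 2 -> loops n i bs ->
  normal_word n (u ++ spin n i) -> normal_word n (u ++ spin n i ++ loop_word n bs).
Proof.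
move=> n3 hi hbs hu; elim: bs hbs => [|[a b] bs IH] hbs; first by rewrite cats0.
have := hbs; rewrite [loops _ _ _]/= => /and4P[h1 h2 h3 h4].
by apply: loop_turn_normal => //=; [lia | lia | exact: IH].
Qed.

Lemma spin_spin_normal n i u : 3 <= n -> i <= n - 2 ->
  normal_word n (u ++ spin n i) -> normal_word n ((u ++ spin n i) ++ spin n i).
Proof.
move=> n3 hi hu; rewrite -catA.
apply: (@loop_turn_normal n i u [::] i i.+1) => //; try lia.
by rewrite cats0.
Qed.

Lemma wpowS v k : wpow v k.+1 = wpow v k ++ v.
Proof.
elim: k => [|k IH]; first by rewrite /wpow /= cats0.
by transitivity (v ++ wpow v k.+1); rewrite // {1}IH catA.
Qed.

Lemma wpow_normal n i k : 3 <= n -> i <= n - 2 -> normal_word n (wpow (spin n i) k.+1).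
Proof.
move=> n3 hi; elim: k => [|k IH]; first by rewrite wpowS; apply: spin_normal.
by rewrite wpowS; rewrite wpowS in IH *; apply: spin_spin_normal.
Qed.

(** Undoing the last move of the latest turn: its descent, then its ascent, then
    its initial n. *)
Lemma loop_rcons_inv n i bs b c : 3 <= n -> i <= n - 2 -> loops n i bs ->
  loop_word n bs = rcons b c ->
  exists2 bs', loops n i bs' & b = loop_word n bs'.
Proof.
move=> n3 hi; case: bs => [|[x y] bs] hbs; first by case: b.
have := hbs; rewrite [loops _ _ _]/= => /and4P[h1 h2 /allP h3 h4].
have -> : loop_word n ((x, y) :: bs) = loop_word n bs ++ turn n x y by [].
case: (y =P n) => [yn|yn].
  rewrite {}yn in h2 h3 *.
  case: x h1 h3 {hbs} => [|x] h1 h3.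
    by rewrite turn0 ?cats1; [case/rcons_inj=> <- _; exists bs | lia].
  rewrite turn_rcons_up -?rcons_cat; last by lia.
  case/rcons_inj=> <- _; exists ((x, n) :: bs) => //=.
  rewrite h4 andbT (_ : all _ _) ?andbT; first by lia.
  by apply/allP=> z /h3 /=; lia.
rewrite turn_rcons_down -?rcons_cat; last by lia.
case/rcons_inj=> <- _; exists ((x, y.+1) :: bs) => //=.
rewrite h4 andbT (_ : all _ _) ?andbT; first by lia.
by apply/allP=> z /h3 /=; lia.
Qed.

Lemma loop_prefix n i bs b : 3 <= n -> i <= n - 2 -> loops n i bs ->
  prefix b (loop_word n bs) -> exists2 bs', loops n i bs' & b = loop_word n bs'.
Proof.
move=> n3 hi hbs /prefixP[t]; elim/last_ind: t bs hbs => [|t c IH] bs hbs e.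
  by exists bs; rewrite // e cats0.
rewrite -rcons_cat in e.
have [bs' hbs' e'] := loop_rcons_inv n3 hi hbs e.
exact: IH hbs' (esym e').
Qed.

(** A movable particle sits above a hole.  If it is at 0, a new turn starts;
    otherwise rules (2) and (3), applied to the last letter of the loop word,
    only allow the latest turn to be continued. *)
Lemma normal_rcons_loop n i u bs c : 3 <= n -> i <= n - 2 -> loops n i bs ->
  normal_word n (rcons (u ++ spin n i ++ loop_word n bs) c) ->
  (exists2 bs', loops n i bs' & loop_word n bs' = rcons (loop_word n bs) c)
  \/ rcons (loop_word n bs) c = spin n i.
Proof.
move=> n3 hi hbs /normal_rcons[_ cF h2 h3].
have cin d : 1 <= d <= n -> d \in rev (u ++ spin n i ++ loop_word n bs).
  by move=> hd; rewrite mem_rev !mem_cat mem_spin // hd orbT.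
have hc0 := cin c cF; rewrite mem_rev in hc0; move/(_ hc0).
rewrite addableE // !(occupied_loops u n3 hi hbs); try by [lia | case: eqP; lia].
case/andP=> h4 h5.
case: bs hbs h2 h3 h4 h5 {cin hc0} => [|[x y] bs] hbs h2 h3 h4 h5.
  rewrite !in_nil !orbF in h4 h5.
  have cn : c = n by move: h4 h5; case: eqP => //=; lia.
  left; exists [:: (0, n)]; first by rewrite /=; lia.
  by rewrite cn /= turn0 //; lia.
have := hbs; rewrite [loops _ _ _]/= => /and4P[g1 g2 g3 g4].
have hx z : z \in unzip1 bs -> x < z.
  by case/mapP=> [[z1 z2] hz /= ->]; have /allP/(_ _ hz)/= := g3; lia.
have hy z : z \in unzip2 bs -> i.+1 < z < y.
  case/mapP=> [[z1 z2] hz /= ->]; have /allP/(_ _ hz)/= := g3.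
  by have /= := loops_bound g4 hz; lia.
rewrite /= !inE in h4 h5.
have all3 a b : a <= x -> (forall z, z \in unzip2 bs -> z < b) ->
    all (fun b' => (a < b'.1) && (b'.2 < b)) bs.
  move=> ax hb; apply/allP=> z zbs; rewrite (hb _ (map_f snd zbs)) andbT.
  exact: leq_ltn_trans ax (hx _ (map_f fst zbs)).
have bs0 : x = i -> bs = [::].
  move=> xi; case: bs g4 hx {hbs h2 h3 h4 h5 g3 hy all3} => // -[b1 b2] bs g4 hx.
  by have /= := hx b1 (mem_head _ _); have /= := loops_bound g4 (mem_head _ _); lia.
case: (c =P n) h4 => [cn|cn] h4.
  left; exists ((0, n) :: (x, y) :: bs); last first.
    by rewrite -cats1 cn -turn0; [rewrite /=|lia].
  rewrite cn prednK in h5; last by lia.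
  have yn : y != n by apply/eqP=> yn; rewrite yn eqxx orbT in h5.
  have n1 : (1 \in unzip2 bs) = false by apply/negP=> /hy; lia.
  have x0 : x != 0 by apply/eqP=> x0; move: h4; rewrite x0 eqxx n1 /=; lia.
  have h0 : all (fun b' => (0 < b'.1) && (b'.2 < n)) bs.
    by apply: all3 => // z /hy; lia.
  by rewrite /= g3 g4 h0; lia.
have ew : loop_word n ((x, y) :: bs) = loop_word n bs ++ turn n x y by [].
have h2' : ~~ (1 < (if y < n then y else if x == 0 then n else x) - c < n - 1).
  rewrite -(@last_turn n x y n) //; [|lia..].
  apply: (h2 (u ++ spin n i ++ loop_word n bs ++ belast n (iota 1 x ++ desc n.-1 y))).
  by rewrite ew !rcons_cat -lastI.
have h3' : y = n -> 0 < x -> ~~ (x.+1 < c < n - 1).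
  move=> yn x0; apply: (h3 (u ++ spin n i ++ loop_word n bs)) => //.
  rewrite ew yn -!catA; congr (_ ++ (_ ++ (_ ++ _))).
  have n0 : n = n.-1.+1 by lia.
  by rewrite /turn {3}n0 desc_nil cats0.
rewrite prednK in h5; last by lia.
case/norP: h5 => h5; case/norP=> cy cJ.
(* Either the descent of the latest turn goes on, or its ascent does. *)
have key : c = y.-1 \/ [/\ y = n, c = x.+1 & c.+1 != n].
  have hcy : c < y.
    case/or3P: h4 => [/andP[h _]|/eqP h|/hy h]; lia.
  case: (ltnP y n) h2' => yn h2'; first by left; lia.
  have {}yn : y = n by lia.
  case: (c.+1 =P n) => [|cn1]; first by left; lia.
  right; split=> //.
  case: (ltnP x c) => hxc.
    by case: (x =P 0) h2' => x0; [|have := h3' yn]; lia.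
  case: (x =P 0) h2' => x0; first by lia.
  case: (x =P c) => [xc|xc] h2'.
    move: h4; rewrite xc eqxx andbF /= => /orP[|/hy]; lia.
  move: h5; rewrite (_ : c.-1 <= i) /=; last by lia.
  by rewrite negbK => /orP[|/hx]; lia.
case: key => [ecy|[yn cx cn1]].
  (* A descent can go down to i + 1 only if site i is a hole, that is, if the
     latest turn is the first one and its ascent went up to i. *)
  case: (y =P i.+2) => [yi|yi].
    right.
    have ci : c.-1 = i by lia.
    move: h5; rewrite ci leqnn andTb negbK => /orP[/eqP xi|].
      rewrite ew bs0 //= -xi ecy yi xi.
      by rewrite /spin [in RHS]turn_rcons_down //; lia.
    case/mapP=> [[z1 z2] hz _]; have := hy z2 (map_f snd hz).
    by have /= := loops_bound g4 hz; lia.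
  left; exists ((x, c) :: bs); last first.
    have yc : y = c.+1 by lia.
    by rewrite ew rcons_cat yc -turn_rcons_down //; lia.
  have h0 : all (fun b' => (x < b'.1) && (b'.2 < c)) bs.
    apply: all3 => // z hz; have := hy z hz.
    have zc : z != c by apply: contraNneq cJ => <-.
    by lia.
  by rewrite /= g4 h0; lia.
have cS : c.+1 \in unzip2 bs = false.
  apply/negP=> hc; have := hy _ hc => hc'.
  have xi : x = i by lia.
  by rewrite (bs0 xi) in hc.
left; exists ((x.+1, n) :: bs); last first.
  by rewrite ew rcons_cat cx yn -turn_rcons_up //; lia.
move: h4; rewrite cS yn (negbTE cn1) !orbF cx => /andP[h41 /norP[_ h42]].
have h0 : all (fun b' => (x.+1 < b'.1) && (b'.2 < n)) bs.
  apply/allP=> -[z1 z2] hz; have := hx _ (map_f fst hz); have := hy _ (map_f snd hz).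
  have /= : z1 != x.+1 by apply: contraNneq h42 => <-; exact: (map_f fst hz).
  by rewrite /=; lia.
by rewrite /= g4 h0; lia.
Qed.

(** * Staircases are the elements of A_i *)

Lemma chain_trans (R : rel nat) (f : nat -> nat) s e : transitive R ->
  (forall q, s <= q < e -> R (f q) (f q.+1)) ->
  forall p q, s <= p < q -> q <= e -> R (f p) (f q).
Proof.
move=> tR hR p; elim=> [|q IH] hp hq; first by lia.
case: (p =P q) => [->|pq]; first by apply: hR; lia.
by apply: (@tR (f q)); [apply: IH; lia | apply: hR; lia].
Qed.

Lemma staircase_size n i ks : staircase n i ks -> size ks <= i.+1.
Proof. by case: ks => //= k ks /and4P[]. Qed.

(** The smallest top is at least the end of its descent, so a one-letter descent
    fits in front. *)
Lemma staircase_ge n i ks : staircase n i ks -> all (leq (i.+2 - size ks)) ks.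
Proof.
case: ks => //= k ks /and4P[h1 h2 /allP h3 h4].
apply/andP; split; first by lia.
by apply/allP=> x /h3 /=; lia.
Qed.

Lemma staircase_iota n i l ks : i <= n - 2 -> 3 <= n -> staircase n i ks ->
  l + size ks <= i.+1 ->
  staircase n i (iota (i.+2 - (l + size ks)) l ++ ks).
Proof.
move=> hi n3 hks; elim: l => [|l IH] //= h.
have e : (i.+2 - (l.+1 + size ks)).+1 = i.+2 - (l + size ks) by lia.
rewrite e IH ?size_iota_cat; last by lia.
rewrite andbT all_cat andbA; apply/andP; split; first by lia.
apply/andP; split; apply/allP=> x; first by rewrite mem_iota /=; lia.
by have /allP h' := staircase_ge hks; move/h' => /=; lia.
Qed.

Lemma staircase_map n i s (k : nat -> nat) d : s + d = i.+1 ->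
  (forall q, s < q <= i.+1 -> q < k q) ->
  (forall q, s < q < i.+1 -> k q < k q.+1) -> k i.+1 < n ->
  staircase n i (map k (iota s.+1 d)) /\
  stair_word i (map k (iota s.+1 d)) = flatten [seq run (k q) q | q <- iota s.+1 d].
Proof.
elim: d s => [|d IH] s //= hs hk hinc hn.
have [h1 h2] : staircase n i (map k (iota s.+2 d)) /\
    stair_word i (map k (iota s.+2 d)) =
    flatten [seq run (k q) q | q <- iota s.+2 d].
  by apply: IH => //; [lia | move=> q hq; apply: hk; lia | move=> q hq; apply: hinc; lia].
have hlt q : s.+1 < q <= i.+1 -> k s.+1 < k q.
  move=> hq; apply: (@chain_trans ltn k s.+1 i.+1) => //; try lia.
  - by move=> a b c; apply: ltn_trans.
rewrite h1 h2 andbT size_map size_iota; split.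
  rewrite (_ : all _ _) ?andbT; last first.
    by apply/allP=> x /mapP[q]; rewrite mem_iota => hq -> /=; apply: hlt; lia.
  have := hk s.+1; case: (s.+1 =P i.+1) => [->|si]; first by lia.
  by have := hlt i.+1; lia.
rewrite run_desc; last by apply: ltnW; apply: hk; lia.
by congr (desc _ _ ++ _); lia.
Qed.

(** The blocks with k_q > q are descents, and the increasing block x_{k_s} ... x_s
    splits into one-letter descents.  Suffixes are handled by [stair_suffix]. *)
Lemma inA_staircase n i a : 3 <= n -> i <= n - 2 -> inA n i a ->
  exists2 ks, staircase n i ks & a = stair_word i ks.
Proof.
move=> n3 hi [s [k [hs hks hk [hinc hn] hsuf]]].
suff [ks h e] : exists2 ks, staircase n i ks & suffix (A_word i s k) (stair_word i ks).
  by apply: stair_suffix h _; apply: suffix_trans hsuf e.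
have [||h1 h2] := @staircase_map n i s k (i.+1 - s) _ hk hinc; [lia|lia|].
have sz : size (map k (iota s.+1 (i.+1 - s))) = i.+1 - s by rewrite size_map size_iota.
case: (posnP s) => [s0|s0].
  exists (map k (iota s.+1 (i.+1 - s))) => //.
  by rewrite h2 s0 /A_word /index_iota subn1 suffix_refl.
have /andP[ks0 kss] := hks s0.
have hl : (s - k s).+1 + size (map k (iota s.+1 (i.+1 - s))) <= i.+1 by lia.
exists (iota (i.+2 - ((s - k s).+1 + size (map k (iota s.+1 (i.+1 - s))))) (s - k s).+1
   ++ map k (iota s.+1 (i.+1 - s))); first exact: staircase_iota.
rewrite stair_word_iota // h2.
rewrite /A_word (maxn_idPr s0) /index_iota subSn; last by lia.
rewrite [iota s _]/= [flatten _]/= {1}/run kss sz.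
have -> : i.+2 - ((s - k s).+1 + (i.+1 - s)) = k s by lia.
exact: suffix_refl.
Qed.

Lemma staircase_nth n i ks j : staircase n i ks -> j.+1 < size ks ->
  nth 0 ks j < nth 0 ks j.+1.
Proof.
elim: ks j => // k ks IH j /= /and4P[_ _ /allP h3 h4] hj.
case: j hj => [|j] hj; last exact: IH.
by apply: h3; apply: mem_nth.
Qed.

(** By [staircase_split] the one-letter descents come first; they form the
    increasing block.  If there are none, the word is a
    proper suffix as soon as s > 0, and k_s can be any number from 1 to s. *)
Lemma staircase_inA n i ks : 3 <= n -> i <= n - 2 -> staircase n i ks ->
  inA n i (stair_word i ks).
Proof.
move=> n3 hi hks; have hsz := staircase_size hks.
have [l [ks2 [e hs2 hst]]] := staircase_split hks.
have sz : size ks = l + size ks2 by rewrite {1}e size_iota_cat.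
have hst' : 0 < size ks2 -> i.+2 - size ks2 < nth 0 ks2 0.
  by case: (ks2) hst => //= k2 ks3 /(_ _ _ (erefl _)).
have [s sE] : exists s, s = i.+1 - size ks2 by exists (i.+1 - size ks2).
pose k q := if q == s then (if 0 < l then i.+2 - size ks else 1)
            else nth 0 ks2 (q - s.+1).
have ks_ : k s = if 0 < l then i.+2 - size ks else 1 by rewrite /k eqxx.
have kq q : s < q -> k q = nth 0 ks2 (q - s.+1) by rewrite /k; case: eqP => //; lia.
have hinc q : s < q < i.+1 -> k q < k q.+1.
  move=> hq; rewrite !kq; [|lia..].
  have -> : q.+1 - s.+1 = (q - s.+1).+1 by lia.
  by apply: staircase_nth hs2 _; lia.
have hk q : s < q <= i.+1 -> q < k q.
  elim: q => [|q IH] hq; first by lia.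
  case: (q =P s) => [qs|qs]; last by have := hinc q; have := IH; lia.
  rewrite kq ?qs ?subnn; last by lia.
  by lia.
have hkn : k i.+1 < n.
  case: (s =P i.+1) => [<-|si]; first by rewrite ks_; case: ifP; lia.
  rewrite kq; last by lia.
  have hj : i.+1 - s.+1 < size ks2 by lia.
  have hm : nth 0 ks2 (i.+1 - s.+1) \in ks2 by apply: mem_nth.
  by case/andP: (staircase_bound hs2 hm).
have h1 : map k (iota s.+1 (size ks2)) = ks2.
  apply: (@eq_from_nth _ 0); first by rewrite size_map size_iota.
  move=> j; rewrite size_map size_iota => hj.
  rewrite (nth_map 0) ?size_iota // nth_iota // kq; last by lia.
  by congr nth; lia.
exists s, k; split.
- by lia.
- by rewrite ks_; case: ifP; lia.
- by [].
- by split=> //; lia.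
have [|_ h2] := @staircase_map n i s k (size ks2) _ hk hinc hkn.
  by have := staircase_size hs2; lia.
rewrite h1 in h2.
rewrite /A_word /index_iota.
have ew : stair_word i ks = iota (i.+2 - size ks) l ++ stair_word i ks2.
  by rewrite {1}e sz stair_word_iota //; lia.
have hs2z := staircase_size hs2.
case: (posnP s) => [s0|s0].
  have l0 : l = 0 by lia.
  have zi : size ks2 = i.+1 by lia.
  by rewrite ew l0 h2 s0 zi subn1 suffix_refl.
rewrite (maxn_idPr s0) (_ : i.+2 - s = (size ks2).+1); last by lia.
rewrite [iota s _]/= [flatten _]/= -h2 ew.
case: (posnP l) ks_ => [->|l0] -> /=; first exact: suffix_suffix.
rewrite /run (_ : _ <= s); last by lia.
rewrite (_ : (s - (i.+2 - size ks)).+1 = l) ?suffix_refl //; lia.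
Qed.

(** * Loop words are the elements of B_i *)

(** Turns numbered 1, ..., r, latest first. *)
Definition turns (I J : nat -> nat) (r : nat) : seq (nat * nat) :=
  rev [seq (I t, J t) | t <- iota 1 r].

Lemma turnsS I J r : turns I J r.+1 = (I r.+1, J r.+1) :: turns I J r.
Proof. by rewrite /turns iota1S map_rcons rev_rcons. Qed.

Lemma turnsP I J r b :
  reflect (exists2 t, 1 <= t <= r & b = (I t, J t)) (b \in turns I J r).
Proof.
rewrite mem_rev; apply: (iffP mapP) => [[t]|[t ht ->]].
  by rewrite mem_iota => ht ->; exists t => //; lia.
by exists t => //; rewrite mem_iota; lia.
Qed.

Lemma loops_turns n i I J r :
  (forall t, 1 <= t <= r -> I t <= i) ->
  (forall t, 1 <= t <= r -> i.+1 < J t <= n) ->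
  (forall t, 1 <= t < r -> I t.+1 < I t) ->
  (forall t, 1 <= t < r -> J t < J t.+1) -> loops n i (turns I J r).
Proof.
elim: r => [|r IH] hI hJ dI dJ //; rewrite turnsS /= hI ?leqnn //.
rewrite IH; first last.
- by move=> t ht; apply: dJ; lia.
- by move=> t ht; apply: dI; lia.
- by move=> t ht; apply: hJ; lia.
- by move=> t ht; apply: hI; lia.
have -> /= : i.+1 < J r.+1 <= n by apply: hJ; lia.
rewrite andbT; apply/allP=> _ /turnsP[t ht ->] /=; apply/andP; split.
  apply: (@chain_trans (fun a b => b < a) I 1 r.+1) => //; try lia.
  by move=> a b c ab bc; apply: ltn_trans bc ab.
apply: (@chain_trans ltn J 1 r.+1) => //; try lia.
by move=> a b c; apply: ltn_trans.
Qed.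

Lemma turns_mono n i I J r : loops n i (turns I J r) ->
  forall t, 1 <= t < r -> I t.+1 < I t /\ J t < J t.+1.
Proof.
elim: r => [|r IH]; first by move=> _ t; lia.
rewrite turnsS => /= /and4P[_ _ /allP h hr] t ht.
case: (t =P r) => [->|tr]; last by apply: IH => //; lia.
have /h/andP[] : (I r, J r) \in turns I J r by apply/turnsP; exists r => //; lia.
by [].
Qed.

Lemma loop_word_turns n r I J : (forall t, 1 <= t <= r -> 0 < I t) ->
  loop_word n (turns I J r) =
  flatten [seq n :: run 1 (I t) ++ desc n.-1 (J t) | t <- iota 1 r].
Proof.
elim: r => // r IH hI.
rewrite turnsS iota1S map_rcons -cats1 flatten_cat -IH; last first.
  by move=> t ht; apply: hI; lia.
by rewrite /= cats0 run1 //; apply: hI; lia.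
Qed.

Lemma turn_desc n j : 0 < n -> j <= n -> turn n 0 j = desc n j.
Proof. by case: n => // n _ hj; rewrite descS. Qed.

(** The last block x_n ... x_{j_{r+1}} is empty or is a turn with no ascent. *)
Lemma inB_loops n i b : 3 <= n -> i <= n - 2 -> inB n i b ->
  exists2 bs, loops n i bs & b = loop_word n bs.
Proof.
move=> n3 hi [r [I [J [hI dI hJ1 [dJ hJ] hb]]]].
have hJt t : 1 <= t <= r.+1 -> i.+1 < J t.
  elim: t => [|[|t] IH] ht //; apply: leq_trans (IH _) (ltnW (dJ _ _)); lia.
have hJn t : 1 <= t <= r -> J t <= n.
  move=> ht; have : J t < J r.+1; last by lia.
  apply: (@chain_trans ltn J 1 r.+1) => //; try lia.
  by move=> a b' c; apply: ltn_trans.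
have hl : loops n i (turns I J r).
  apply: loops_turns => // t ht.
  - by have := hI t ht; lia.
  - by have := hJt t; have := hJn t ht; lia.
  - by apply: dJ; lia.
have ew := @loop_word_turns n r I J (fun t ht => proj1 (andP (hI t ht))).
rewrite /B_word -ew in hb.
case: (J r.+1 =P n.+1) => [jn|jn].
  by move: hb; rewrite jn desc_nil cats0; apply: loop_prefix.
apply: (@loop_prefix n i ((0, J r.+1) :: turns I J r)) => //; last first.
  by rewrite /= -/(turn n 0 (J r.+1)) turn_desc //; lia.
rewrite /= hl andbT; apply/andP; split; first by have := hJt r.+1; lia.
apply/allP=> _ /turnsP[t ht ->] /=; rewrite (_ : 0 < I t); last by have := hI t ht; lia.
apply: (@chain_trans ltn J 1 r.+1) => //; try lia.
by move=> a b' c; apply: ltn_trans.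
Qed.

(** The bound e plays the role of j_{r+1}. *)
Lemma loops_inB_last n i bs e : i.+1 < e <= n.+1 -> loops n i bs ->
  all (fun b => (0 < b.1) && (b.2 < e)) bs -> inB n i (loop_word n bs ++ desc n e).
Proof.
move=> he hbs /allP hall.
pose I t := nth 0 (unzip1 (rev bs)) t.-1.
(* The default value e makes J (size bs).+1 equal to e. *)
pose J t := nth e (unzip2 (rev bs)) t.-1.
have ebs : turns I J (size bs) = bs.
  apply: (can_inj revK); rewrite revK.
  apply: (@eq_from_nth _ (0, e)); first by rewrite size_map size_iota size_rev.
  move=> j; rewrite size_map size_iota => hj.
  rewrite (nth_map 0) ?size_iota // nth_iota // /I /J add1n /=.
  by rewrite !(nth_map (0, e)) ?size_rev //; case: nth.
have hin t : 1 <= t <= size bs -> (I t, J t) \in bs.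
  by move=> ht; rewrite -ebs; apply/turnsP; exists t.
have hJlast : J (size bs).+1 = e by rewrite /J nth_default // size_map size_rev.
have hmono : forall t, 1 <= t < size bs -> I t.+1 < I t /\ J t < J t.+1.
  by apply: (@turns_mono n i); rewrite ebs.
exists (size bs), I, J; split.
- by move=> t /hin hb; have := hall _ hb; have /= := loops_bound hbs hb; lia.
- by move=> t /hmono[].
- case: (posnP (size bs)) => [s0|s0]; first by move: hJlast; rewrite s0 => ->; lia.
  by have hb := hin 1 s0; have /= := loops_bound hbs hb; lia.
- split=> [t ht|]; last by rewrite hJlast; lia.
  case: (t =P size bs) => [ts|ts]; last by have [] := hmono t ltac:(lia).
  by move: hJlast; rewrite -ts => ->; case/andP: (hall _ (hin t ht)).
rewrite /B_word -loop_word_turns ?ebs ?hJlast ?prefix_refl //.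
by move=> t /hin /hall /andP[].
Qed.

(** If the latest turn has no ascent it is the last block of the word;
    otherwise the last block is empty, with j_{r+1} = n + 1. *)
Lemma loops_inB n i bs : 3 <= n -> i <= n - 2 -> loops n i bs ->
  inB n i (loop_word n bs).
Proof.
move=> n3 hi hbs.
case: (boolP (all (fun b => 0 < b.1) bs)) => [/allP hall|].
  rewrite -[loop_word n bs]cats0 -(desc_nil n).
  apply: loops_inB_last => //; first by lia.
  apply/allP=> -[b1 b2] hb; rewrite hall //=.
  by have /= := loops_bound hbs hb; lia.
case: bs hbs => // [[x y] bs].
rewrite [loops _ _ _]/= => /and4P[g1 g2 g3 g4] hx.
have x0 : x = 0.
  apply/eqP; apply: contraR hx; rewrite -lt0n => x0 /=.
  by rewrite x0 /=; apply: sub_all g3 => b; lia.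
rewrite /= x0 -/(turn n 0 y) turn_desc; [|lia..].
apply: loops_inB_last => //; first by lia.
by rewrite -x0.
Qed.

(** * The classification *)

Theorem theorem2p1 :
  forall n : nat, 3 <= n ->
    (forall (w : seq nat) (i : nat),
       reduced n w -> i <= n - 2 -> infix (n :: q_word n i) w ->
       exists (a b : seq nat) (k : nat),
         [/\ inA n i a, inB n i b, 1 <= k
           & w = a ++ wpow (n :: q_word n i) k ++ b])
    /\
    (forall (i : nat) (a b : seq nat) (k : nat),
       i <= n - 2 -> inA n i a -> inB n i b -> 1 <= k ->
       reduced n (a ++ wpow (n :: q_word n i) k ++ b)).
Proof.
move=> n n3; split=> [w i hw hi|i a b k hi ha hb hk]; last first.
  rewrite spinE //; last by lia.
  have [ks hks ->] := inA_staircase n3 hi ha.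
  have [bs hbs ->] := inB_loops n3 hi hb.
  case: k hk => // k _; apply/reduced_normal => //.
  rewrite -[wpow _ k.+1]/(spin n i ++ wpow (spin n i) k) -catA.
  apply: stair_normal => //; rewrite catA -[spin n i ++ wpow _ k]/(wpow _ k.+1) wpowS -catA.
  by apply: loop_normal => //; rewrite -wpowS; apply: wpow_normal.
rewrite spinE //; last by lia.
case/infixP=> u [v e]; move/reduced_normal: hw => /(_ n3); rewrite {w}e.
have right_part : normal_word n (spin n i ++ v) -> exists2 bs, loops n i bs &
    exists k, spin n i ++ v = wpow (spin n i) k ++ spin n i ++ loop_word n bs.
  elim/last_ind: v => [|v c IH].
    by exists [::] => //; exists 0; rewrite !cats0.
  rewrite -rcons_cat => hR.
  have [hR' _ _ _ _] := iffLR (normal_rcons _ _ _) hR.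
  have [bs hbs [k e]] := IH hR'; rewrite e in hR *.
  case: (normal_rcons_loop n3 hi hbs hR) => [[bs' hbs' e']|e'].
    by exists bs' => //; exists k; rewrite !rcons_cat e'.
  by exists [::] => //; exists k.+1; rewrite wpowS !rcons_cat e' cats0 catA.
have left_part : normal_word n (u ++ spin n i ++ v) -> exists2 ks, staircase n i ks &
    exists k, u ++ spin n i ++ v = stair_word i ks ++ wpow (spin n i) k ++ spin n i ++ v.
  elim: u => [|c u IH]; first by exists [::] => //; exists 0.
  rewrite cat_cons => hR; have [hR' _ _ _ _] := iffLR (normal_cons _ _ _) hR.
  have [ks hks [k e]] := IH hR'; rewrite e in hR *.
  have {}hR : normal_word n (c :: stair_word i ks ++ spin n i ++ wpow (spin n i) k ++ v).
    by move: hR; rewrite [wpow _ _ ++ _ ++ _]catA -wpowS -[wpow _ k.+1]/(spin n i ++ wpow _ k) -catA.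
  case: (normal_cons_stair n3 hi hks hR) => [[ks' hks' e']|e'].
    by exists ks' => //; exists k; rewrite e'.
  exists [::] => //; exists k.+1.
  by rewrite -cat_cons e' -[wpow _ k.+1]/(spin n i ++ wpow _ k) -[in RHS]catA.
move=> hR; have [ks hks [k e]] := left_part hR.
have hR2 : normal_word n (spin n i ++ v).
  have drop u' : normal_word n (u' ++ spin n i ++ v) -> normal_word n (spin n i ++ v).
    by elim: u' => // c u' IH /normal_cons[hR' _ _ _ _]; apply: IH.
  exact: drop hR.
have [bs hbs [k' e']] := right_part hR2.
exists (stair_word i ks), (loop_word n bs), (k + k'.+1); split.
- exact: staircase_inA.
- exact: loops_inB.
- by lia.
rewrite e e'; congr (_ ++ _).
have wpowD l m : wpow (spin n i) (l + m) = wpow (spin n i) l ++ wpow (spin n i) m.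
  by rewrite /wpow nseqD flatten_cat.
by rewrite wpowD wpowS -!catA.
Qed.
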